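(* Let $S \in \mathscr{L}(A)$ be a Markov operator on a commutative unital $\mathrm{C}^*$-algebra $A$ and let $T \in \mathscr{L}(E)$ be an $S$-dominated operator on a pre-Hilbert module $E$ over $A$. Moreover, let $x \in E$, let $(N_i)_{i \in I}$ be a subnet of $\mathbb{N}$, and let $\mu_i \in \mathrm{S}(A)$ be a state on $A$ for every $i \in I$. Then $$\limsup_{i} \left\langle \left|\frac{1}{N_i} \sum_{n=0}^{N_i-1} T^n x\right|_A^2, \mu_i\right\rangle \leq \liminf_{J \to \infty} \frac{1}{J}\sum_{j=1}^{J} \limsup_{i} \frac{1}{N_i} \sum_{n=0}^{N_i-1} \operatorname{Re} \left\langle S^n(x|T^jx)_A, \mu_i\right\rangle.$$
   Context: $\mathbb{N} = \{1,2,3,\dots\}$. A Markov operator on a commutative unital $\mathrm{C}^*$-algebra $A$ is a bounded linear operator $S\in\mathscr{L}(A)$ that is unital ($S\mathbf{1}=\mathbf{1}$) and positive ($Sa \geq 0$ whenever $a \geq 0$). A pre-Hilbert module $E$ over a unital $\mathrm{C}^*$-algebra $A$ is a unital left module $E$ over the algebra $A$ (so $1\cdot x = x$ for all $x \in E$) together with a map $(\cdot|\cdot)_A \colon E \times E \to A$ such that (i) $(x|x)_A \geq 0$, and $(x|x)_A = 0$ if and only if $x = 0$, for $x \in E$; (ii) $(x|y)_A^* = (y|x)_A$ for all $x,y\in E$; (iii) $(\cdot|y)_A \colon E \to A$ is $A$-linear for every $y \in E$. For commutative $A$ put $|x|_A = (x|x)_A^{1/2}$ (square root by continuous functional calculus)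 and $\|x\| = \||x|_A\|$ for $x \in E$; this is a norm on $E$, with respect to which $E$ need not be complete, and $\mathscr{L}(E)$ denotes the bounded linear operators on $E$ for this norm. An operator $T \in \mathscr{L}(E)$ is $S$-dominated, for a Markov operator $S \in \mathscr{L}(A)$, if $|Tx|_A^2 \leq S|x|_A^2$ for all $x \in E$. $\mathrm{S}(A) \subset A'$ denotes the set of states on $A$ (positive linear functionals of norm $1$), and $\langle a,\mu\rangle = \mu(a)$. A subnet $(N_i)_{i\in I}$ of $\mathbb{N}$ is a subnet of the sequence $(N)_{N\in\mathbb{N}}$; in particular $I$ is a directed set, $N_i\in\mathbb{N}$, and $N_i \to \infty$ along $I$. For a net $(a_i)_{i\in I}$ of real numbers, $\limsup_i a_i = \inf_{k \in I} \sup_{i \geq k} a_i$. *)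

(* Defs.v *)
From HB Require Import structures.
From mathcomp Require Import all_boot all_order all_algebra.
From mathcomp Require Import complex.
From mathcomp Require Import all_classical all_reals.
From mathcomp Require Import ereal normedtype sequences.
Import Order.TTheory GRing.Theory Num.Theory.
Import ComplexField.Normc.

Set Implicit Arguments.
Unset Strict Implicit.
Unset Printing Implicit Defensive.

Local Open Scope classical_set_scope.
Local Open Scope ring_scope.
Local Open Scope complex_scope.

(* Scalars are R[i] with R : realType; on R[i], [0 <= z] means that z is a
   nonnegative real and [normc] is the R-valued modulus.
   The norm of a C*-algebra is a field of the structure below because the
   normed modules of MathComp-Analysis cannot be joined with the algebras of
   ssralg (the hierarchy lacks the joins below numDomainType). *)

HB.mixin Record isCommCStarAlgebra (R : realType) A
    of GRing.ComAlgebra R[i] A := {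
  star : A -> A;
  starK : forall a, star (star a) = a;
  starD : forall a b, star (a + b) = star a + star b;
  starM : forall a b, star (a * b) = star b * star a;
  starZ : forall (c : R[i]) a, star (c *: a) = c^* *: star a;
  cnorm : A -> R;
  cnorm_eq0 : forall a, cnorm a = 0 -> a = 0;
  ler_cnormD : forall a b, cnorm (a + b) <= cnorm a + cnorm b;
  cnormZ : forall (c : R[i]) a, cnorm (c *: a) = normc c * cnorm a;
  ler_cnormM : forall a b, cnorm (a * b) <= cnorm a * cnorm b;
  cnorm_starM : forall a, cnorm (star a * a) = cnorm a ^+ 2;
  cnorm_complete : forall u : nat -> A,
    (forall e : R, 0 < e -> exists K : nat, forall m n : nat,
       (K <= m)%N -> (K <= n)%N -> cnorm (u m - u n) <= e) ->
    exists l : A, forall e : R, 0 < e -> exists K : nat, forall n : nat,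
       (K <= n)%N -> cnorm (u n - l) <= e
}.

#[short(type="commCStarType")]
HB.structure Definition CommCStarAlgebra (R : realType) :=
  {A of isCommCStarAlgebra R A & GRing.ComAlgebra R[i] A}.

Section CStar.
Context {R : realType} {A : commCStarType R}.
Implicit Types a b : A.

Definition spectrum a : set R[i] :=
  [set z | ~ exists b : A, b * (z%:A - a) = 1].

Definition cpos a : Prop :=
  star a = a /\ (forall z, spectrum a z -> 0 <= z).

Definition cle a b : Prop := cpos (b - a).

(* The continuous functional calculus at a self-adjoint a: its spectrum is
   compact and real, so polynomials are dense in C(spectrum a), and f(a) is the
   extension of p |-> p(a) by uniform limits. *)
Definition is_cfc (f : R[i] -> R[i]) a b : Prop :=
  forall e : R, 0 < e -> exists p : {poly R[i]},
    (forall z, spectrum a z -> normc (p.[z] - f z) <= e) /\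
    cnorm (horner_alg a p - b) <= e.

Definition cfc (f : R[i] -> R[i]) a : A := xget 0 [set b | is_cfc f a b].

Definition csqrt a : A := cfc sqrtC a.

Definition markov_operator (S : {linear A -> A}) : Prop :=
  [/\ exists M : R, forall a, cnorm (S a) <= M * cnorm a,
      S 1 = 1
    & forall a, cpos a -> cpos (S a)].

Definition functional_norm (mu : {scalar A}) : R :=
  sup [set normc (mu a) | a in [set a : A | cnorm a <= 1]].

(* Boundedness is explicit since [sup] of an unbounded set is a junk value. *)
Definition state (mu : {scalar A}) : Prop :=
  [/\ exists M : R, forall a, normc (mu a) <= M * cnorm a,
      forall a, cpos a -> 0 <= mu a
    & functional_norm mu = 1].

End CStar.

HB.mixin Record isPreHilbert (R : realType) (A : commCStarType R) E
    of GRing.Lmodule A E := {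
  inner : E -> E -> A;
  inner_pos : forall x, cpos (inner x x);
  inner_eq0 : forall x, inner x x = 0 <-> x = 0;
  inner_star : forall x y, star (inner x y) = inner y x;
  inner_linear : forall (a : A) x y z,
    inner (a *: x + y) z = a * inner x z + inner y z
}.

#[short(type="preHilbertType")]
HB.structure Definition PreHilbert (R : realType) (A : commCStarType R) :=
  {E of isPreHilbert R A E & GRing.Lmodule A E}.

Section Module.
Context {R : realType} {A : commCStarType R} {E : preHilbertType A}.
Implicit Types (x : E) (T : E -> E).

Definition modulus x : A := csqrt (inner x x).

Definition mnorm x : R := cnorm (modulus x).

(* E is a complex vector space through c |-> c 1_A; operators in L(E) are
   linear over R[i], in general not over A. *)
Definition bounded_operator T : Prop :=
  (forall (c : R[i]) x y, T (c%:A *: x + y) = c%:A *: T x + T y) /\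
  exists M : R, forall x, mnorm (T x) <= M * mnorm x.

Definition dominated (S : A -> A) T : Prop :=
  forall x, cle (modulus (T x) ^+ 2) (S (modulus x ^+ 2)).

Definition ergodic_average T (N : nat) x : E :=
  ((N%:R^-1 : R[i])%:A : A) *: \sum_(0 <= n < N) iter n T x.

End Module.

Section Nets.
Context {I : Type}.

Definition directed (le : I -> I -> Prop) : Prop :=
  [/\ inhabited I, forall i, le i i,
      forall i j k, le i j -> le j k -> le i k
    & forall i j, exists k, le i k /\ le j k].

(* N is a subnet, indexed by (I, le), of the sequence 1, 2, 3, ...; it need
   not be monotone. *)
Definition subnet_of_nat (le : I -> I -> Prop) (N : I -> nat) : Prop :=
  [/\ directed le, forall i, (0 < N i)%N
    & forall m : nat, exists k, forall i, le k i -> (m <= N i)%N].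

(* Taken in the extended reals, hence with no boundedness requirement. *)
Definition net_limsup {R : realType} (le : I -> I -> Prop) (a : I -> R) :
    \bar R :=
  ereal_inf [set ereal_sup [set (a i)%:E | i in [set i | le k i]]
            | k in [set: I]].

End Nets.

(* Main.v *)
Require Import Defs.
From HB Require Import structures.
From mathcomp Require Import all_boot all_order all_algebra.
From mathcomp Require Import complex ring lra.
From mathcomp Require Import all_classical all_reals.
From mathcomp Require Import ereal topology normedtype sequences.
Import Order.TTheory GRing.Theory Num.Theory.
Import ComplexField.Normc numFieldNormedType.Exports.

(** Fix a level [L] below the limit superior on the left, and an ultrafilter [F]
    refining the net on which the left-hand terms stay above [L].  Limits along
    [F] exist for all bounded nets, so that
    [[
      B u v = lim_F (1 / N_i) sum_(n < N_i) Re mu_i (S^n (u|v))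
    ]]
    is a real positive semidefinite form on [E].  Domination gives
    [|T u|^2 <= S |u|^2], whence [B (T u) (T u) <= B u u]: the means of [S^n]
    and of [S^(n+1)] differ by [O(1 / N_i)].  Since [|T^n v|^2 <= S^n |v|^2],
    convexity bounds the left-hand term for [v] by the mean of [S^n |v|^2]; and
    replacing [x] by [v = x + (w - T w)] changes the averages by [O(1 / N_i)].
    Therefore [L <= B v v] for every such [v] ([limit_form_ge] and
    [form_ergodic_average_le]).

    What remains is the mean ergodic theorem for a contraction [T] of a
    semi-inner product space: if [L] is a lower bound of [B v v] on the affine
    space [x + (1 - T) E], then [B x] evaluated at the average of
    [T x, ..., T^J x] is at least [L - e] for all large [J]
    ([mean_ergodic_lower_bound]).  By linearity that value is the mean of
    [B x (T^j x)], and each of these limits along [F] is at most the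
    corresponding limit superior of the net, which gives the claim.

    The C*-algebraic input is that the modulus, defined by functional calculus,
    satisfies [|x|^2 = (x|x)] ([modulus_sqr]).  This rests on the estimate of
    the norm of [p(a)], for a polynomial [p] and a positive [a], by the supremum
    of [|p|] on the spectrum ([cnorm_horner_alg]), and hence on the fact that the
    norm of a self-adjoint element is attained on its spectrum
    ([spectrum_norm_attained]).  The latter is proved without complex analysis:
    if [|h| = 1] and [1 - h^2] were invertible, then [h] would be the real part
    of an element of norm less than 1 ([one_minus_sqr_not_unit]). *)

Set Implicit Arguments.
Unset Strict Implicit.
Unset Printing Implicit Defensive.
Local Open Scope classical_set_scope.
Local Open Scope ring_scope.
Local Open Scope complex_scope.

(** * Norm and involution *)

Section NormTheory.
Context {R : realType} {A : commCStarType R}.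
Implicit Types (a b h k y z : A) (r rho e : R).

Lemma normc_real r : normc (r%:C) = `|r|.
Proof. by rewrite /= expr0n addr0 sqrtr_sqr. Qed.

Lemma cnormR r a : cnorm (r%:C *: a) = `|r| * cnorm a.
Proof. by rewrite cnormZ normc_real. Qed.

Lemma cnorm0 : cnorm (0 : A) = 0.
Proof. by rewrite -(scale0r (0 : A)) cnormZ normc0 mul0r. Qed.

Lemma cnormN a : cnorm (- a) = cnorm a.
Proof. by rewrite -scaleN1r cnormZ normcN normc1 mul1r. Qed.

Lemma cnorm_ge0 a : 0 <= cnorm a.
Proof.
have := ler_cnormD a (- a); rewrite subrr cnorm0 cnormN; lra.
Qed.

Lemma cnorm_gt0 a : a != 0 -> 0 < cnorm a.
Proof.
move=> a0; rewrite lt0r cnorm_ge0 andbT.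
by apply: contra_neq a0 => /cnorm_eq0.
Qed.

Lemma ler_cnormB a b : cnorm (a - b) <= cnorm a + cnorm b.
Proof. by rewrite -(cnormN b) ler_cnormD. Qed.

Lemma cnorm_distC a b : cnorm (a - b) = cnorm (b - a).
Proof. by rewrite -cnormN opprB. Qed.

Lemma star0 : star (0 : A) = 0.
Proof. by apply: (addrI (star 0)); rewrite -starD !addr0. Qed.

Lemma starN a : star (- a) = - star a.
Proof. by apply: (addrI (star a)); rewrite -starD !subrr star0. Qed.

Lemma starB a b : star (a - b) = star a - star b.
Proof. by rewrite starD starN. Qed.

Lemma star1 : star (1 : A) = 1.
Proof. by have := starM (1 : A) (star 1); rewrite mul1r starK mul1r. Qed.

Lemma starR r a : star (r%:C *: a) = r%:C *: star a.
Proof. by rewrite starZ; congr (_ *: _); apply: conjc_real. Qed.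

Lemma cnorm1 : cnorm (1 : A) = 1.
Proof.
have := cnorm_starM (1 : A); rewrite star1 mulr1 => /eqP.
rewrite expr2 -subr_eq0 -{1}[cnorm 1]mulr1 -mulrBr mulf_eq0 subr_eq0.
case/orP=> [/eqP /cnorm_eq0 /eqP|/eqP //]; first by rewrite oner_eq0.
Qed.

Lemma cnorm_scalar (z : R[i]) : cnorm (z%:A : A) = normc z.
Proof. by rewrite cnormZ cnorm1 mulr1. Qed.

Lemma cnorm_star a : cnorm (star a) = cnorm a.
Proof.
have le_star b : cnorm b <= cnorm (star b).
  have [->|b0] := eqVneq b 0; first by rewrite star0.
  rewrite -(ler_pM2r (cnorm_gt0 b0)) -expr2 -cnorm_starM.
  exact: ler_cnormM.
by apply/eqP; rewrite eq_le le_star -{2}(starK a) le_star.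
Qed.

Lemma cnorm_sqr h : star h = h -> cnorm (h ^+ 2) = cnorm h ^+ 2.
Proof. by move=> sh; rewrite -cnorm_starM sh. Qed.

(** * Consequences of completeness *)

Lemma geometric_small rho r e : 0 <= rho -> rho < 1 -> 0 < e ->
  exists K, forall n, (K <= n)%N -> rho ^+ n * r <= e.
Proof.
move=> rho0 rho1 e0.
have /cvgrPdist_le /(_ _ e0) [K _ HK] : (fun n => rho ^+ n * r) @ \oo --> (0 : R).
  rewrite -(mul0r r); apply: cvgM; last exact: cvg_cst.
  by apply: cvg_expr; rewrite ger0_norm.
exists K => n /HK /=; rewrite sub0r normrN.
exact: le_trans (ler_norm _).
Qed.

(** Inverses and square roots near the unit are fixed points of contractions;
    this replaces their power series. *)
Lemma banach_fixed_point (f : A -> A) r rho :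
  0 <= r -> 0 <= rho -> rho < 1 ->
  (forall y, cnorm y <= r -> cnorm (f y) <= r) ->
  (forall y z, cnorm y <= r -> cnorm z <= r ->
     cnorm (f y - f z) <= rho * cnorm (y - z)) ->
  exists2 l, cnorm l <= r & f l = l.
Proof.
move=> r0 rho0 rho1 fball flip; pose u n := iter n f 0.
have iter_ball n y : cnorm y <= r -> cnorm (iter n f y) <= r.
  by move=> yr; elim: n => //= n /fball.
have u_ball n : cnorm (u n) <= r by apply: iter_ball; rewrite cnorm0.
have iter_lip n y : cnorm y <= r -> cnorm (iter n f y - u n) <= rho ^+ n * r.
  move=> yr; elim: n => [|n IHn]; first by rewrite subr0 mul1r.
  rewrite exprS -mulrA /u /=; apply: le_trans (ler_wpM2l rho0 IHn).
  by apply: flip; [exact: iter_ball|exact: u_ball].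
have uD m n : (n <= m)%N -> cnorm (u m - u n) <= rho ^+ n * r.
  by move=> nm; rewrite /u -(subnKC nm) iterD; exact/iter_lip/u_ball.
have [|l ul] := @cnorm_complete R A u.
  move=> e e0; have [K HK] := geometric_small r rho0 rho1 e0.
  exists K => m n Km Kn; have [mn|/ltnW nm] := leqP m n.
    by rewrite cnorm_distC; apply: le_trans (uD _ _ mn) (HK _ Km).
  exact: le_trans (uD _ _ nm) (HK _ Kn).
have lr : cnorm l <= r.
  apply/ler_addgt0Pr => e /ul [K /(_ _ (leqnn K)) uK].
  rewrite -[l](subKr (u K)); apply: le_trans (ler_cnormB _ _) _.
  exact: lerD.
exists l => //; apply/eqP; rewrite -subr_eq0; apply/eqP/cnorm_eq0/eqP.
rewrite eq_le cnorm_ge0 andbT; apply/ler_addgt0Pr => e e0; rewrite add0r.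
have [|K HK] := ul (e / 2); first by rewrite divr_gt0.
rewrite -(subrKA (u K.+1)); apply: le_trans (ler_cnormD _ _) _.
rewrite (splitr e); apply: lerD; last exact: HK.
apply: le_trans (flip _ _ lr (u_ball K)) _.
rewrite cnorm_distC; have := HK _ (leqnn K); have := cnorm_ge0 (u K - l); nra.
Qed.

Lemma neumann_inverse k rho : 0 <= rho -> rho < 1 -> cnorm k <= rho ->
  exists2 b, b * (1 - k) = 1 & cnorm b <= (1 - rho)^-1.
Proof.
move=> rho0 rho1 kr.
have r10 : 0 < 1 - rho by rewrite subr_gt0.
have [| | | | |b br bE] := @banach_fixed_point (fun y => 1 + k * y) (1 - rho)^-1 rho.
- by rewrite invr_ge0 ltW.
- by [].
- by [].
- move=> y yr; apply: le_trans (ler_cnormD _ _) _; rewrite cnorm1.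
  apply: le_trans (lerD (lexx 1) (le_trans (ler_cnormM _ _)
    (ler_pM (cnorm_ge0 _) (cnorm_ge0 _) kr yr))) _.
  by have := mulfV (lt0r_neq0 r10); lra.
- move=> y z _ _; rewrite opprD addrACA subrr add0r -mulrBr.
  by apply: le_trans (ler_cnormM _ _) _; rewrite ler_wpM2r ?cnorm_ge0.
by exists b => //; rewrite mulrBr mulr1 -{1}bE mulrC addrK.
Qed.

(** The square root is [1 - y] for the fixed point [y] of the contraction
    [y |-> (k + y ^+ 2) / 2]; it is self-adjoint because its adjoint is a fixed
    point too. *)
Lemma sqrt_one_minus k rho : 0 <= rho -> rho < 1 -> cnorm k <= rho ->
  star k = k -> exists2 w, star w = w & w ^+ 2 = 1 - k.
Proof.
move=> rho0 rho1 kr sk.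
pose f y := (2^-1 : R)%:C *: (k + y ^+ 2).
have h2 : `|2^-1 : R| = 2^-1 by rewrite ger0_norm // invr_ge0.
have fball y : cnorm y <= rho -> cnorm (f y) <= rho.
  move=> yr; rewrite cnormR h2.
  have := ler_cnormD k (y ^+ 2); have := ler_cnormM y y.
  have := cnorm_ge0 y; rewrite -expr2; nra.
have flip y z : cnorm y <= rho -> cnorm z <= rho ->
    cnorm (f y - f z) <= rho * cnorm (y - z).
  move=> yr zr; rewrite -scalerBr cnormR h2.
  rewrite opprD addrACA subrr add0r subr_sqr.
  have := ler_cnormM (y - z) (y + z); have := ler_cnormD y z.
  have := cnorm_ge0 (y - z); have := cnorm_ge0 (y + z); nra.
have [l lr fl] := banach_fixed_point rho0 rho0 rho1 fball flip.
have sl : star l = l.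
  have fsl : f (star l) = star l.
    by rewrite -[in RHS]fl /f starR starD sk !expr2 starM.
  have slr : cnorm (star l) <= rho by rewrite cnorm_star.
  apply/eqP; rewrite -subr_eq0; apply/eqP/cnorm_eq0.
  by have := flip _ _ slr lr; rewrite fsl fl; have := cnorm_ge0 (star l - l); nra.
exists (1 - l); first by rewrite starB star1 sl.
have : l *+ 2 = k + l ^+ 2.
  rewrite -[in LHS]fl /f -scaler_nat scalerA.
  have -> : (2%:R : R[i]) = (2 : R)%:C by rewrite rmorph_nat.
  by rewrite -rmorphM /= mulfV // scale1r.
by move=> l2; rewrite sqrrB expr1n mul1r l2 opprD addrA subrK.
Qed.

End NormTheory.

(** * The norm of a self-adjoint element is attained on its spectrum *)

Section SpectralNorm.
Context {R : realType} {A : commCStarType R}.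
Implicit Types (a b c g h : A) (p q : {poly R[i]}).

Lemma scale_in_alg (k : R[i]) a : k *: a = in_alg A k * a.
Proof. by rewrite mulr_algl. Qed.

Lemma star_inverse a b : star a = a -> b * a = 1 -> star b = b.
Proof.
move=> sa ba; have sba : star b * a = 1 by rewrite -sa -starM mulrC ba star1.
by rewrite -[star b]mulr1 -ba mulrCA sba mulr1.
Qed.

Lemma not_inverse0 b : b * 0 = 1 -> False.
Proof. by move=> /eqP; rewrite mulr0 eq_sym oner_eq0. Qed.

(** If [l = 1 - h^2] were invertible, then [l - eta] would still be a square
    [p^2] of a self-adjoint [p] for small [eta > 0].  Then [u = h + i p]
    satisfies [u^* u = h^2 + p^2 = 1 - eta], so that
    [|h| = |(u + u^* ) / 2| <= |u| < 1].  The root [p] comes from the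
    factorization [l - eta = (l + eta) (1 - 2 eta (l + eta)^-1)]: both factors
    are, up to a scalar, within distance less than 1 of the unit, the first one
    because [l + eta = (1 + eta) - h^2] and [|h| = 1]. *)
Lemma one_minus_sqr_not_unit h g :
  star h = h -> cnorm h = 1 -> g * (1 - h ^+ 2) = 1 -> False.
Proof.
move=> sh h1 gl; set l : A := 1 - h ^+ 2 in gl.
have sl : star l = l by rewrite starB star1 expr2 starM sh.
have sg := star_inverse sl gl.
have G0 := cnorm_ge0 g.
pose eta : R := (4 * (cnorm g + 1))^-1.
have etaE : eta * (4 * (cnorm g + 1)) = 1 by rewrite mulVf // lt0r_neq0 //; lra.
have eta0 : 0 < eta by rewrite invr_gt0; lra.
have etaG : eta * cnorm g <= 4^-1 by nra.
have eta1 : eta < 1 by nra.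
(* the inverse g' of l + eta has norm at most 4/3 |g| *)
have [b bE b43] : exists2 b : A,
    b * (1 - - (eta%:C *: g)) = 1 & cnorm b <= (1 - 4^-1)^-1.
  apply: neumann_inverse; [lra|lra|].
  by rewrite cnormN cnormR ger0_norm // ltW.
pose g' := g * b.
have g'E : g' * (l + eta%:C%:A) = 1.
  have -> : g' * (l + eta%:C%:A) = b * (1 - - (eta%:C *: g)) + b * (g * l - 1).
    by rewrite /g' !scale_in_alg; ring.
  by rewrite gl subrr mulr0 addr0.
have sle : star (l + eta%:C%:A) = l + eta%:C%:A by rewrite starD sl starR star1.
have sg' := star_inverse sle g'E.
have g'n : 2 * eta * cnorm g' <= 2 / 3.
  have := ler_cnormM g b; have := cnorm_ge0 b.
  have : (1 - 4^-1 : R)^-1 = 4 / 3 by field.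
  rewrite -/g'; move: b43 => /[swap] ->; nra.
have [v sv v2] : exists2 v : A, star v = v & v ^+ 2 = 1 - (2 * eta)%:C *: g'.
  apply: (@sqrt_one_minus _ _ _ (2 / 3)); [lra|lra| |by rewrite starR sg'].
  by rewrite cnormR ger0_norm // ltW //; lra.
have e10 : 0 < 1 + eta by lra.
have [w sw w2] : exists2 w : A, star w = w & w ^+ 2 = 1 - (1 + eta)^-1%:C *: h ^+ 2.
  apply: (@sqrt_one_minus _ _ _ (1 + eta)^-1).
  - by rewrite invr_ge0 ltW.
  - by rewrite invf_lt1 //; lra.
  - by rewrite cnormR cnorm_sqr // h1 expr1n mulr1 ger0_norm // invr_ge0 ltW.
  - by rewrite starR expr2 starM sh.
pose p := (Num.sqrt (1 + eta))%:C *: (w * v).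
have sp : star p = p by rewrite starR starM sw sv mulrC.
have p2 : h ^+ 2 + p ^+ 2 = (1 - eta)%:C%:A.
  have -> : p ^+ 2 = ((1 + eta)%:C *: w ^+ 2) * v ^+ 2.
    rewrite -[in RHS](sqr_sqrtr (ltW e10)) /p !scale_in_alg; ring.
  have -> : (1 + eta)%:C *: w ^+ 2 = l + eta%:C%:A.
    rewrite w2 scalerBr scalerA -rmorphM /= mulfV ?lt0r_neq0 // scale1r /l.
    by rewrite !scale_in_alg; ring.
  rewrite v2 mulrBr mulr1 -scalerAr [_ * g']mulrC g'E /l.
  by rewrite !scale_in_alg; ring.
pose i : R[i] := 0 +i* 1; pose u := h + i *: p.
have su : star u = h - i *: p.
  have iJ : (i^*)%R = - i.
    by rewrite /i; apply/eqP; rewrite eq_complex /= oppr0 !eqxx.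
  by rewrite starD sh starZ sp iJ scaleNr.
have := cnorm_starM u; rewrite su.
have -> : (h - i *: p) * u = h ^+ 2 + p ^+ 2.
  by rewrite /u -subr_sqr exprZn sqr_i scaleN1r opprK.
rewrite p2 cnorm_scalar normc_real ger0_norm; last by lra.
move=> u2; have := ler_cnormD u (star u); rewrite cnorm_star su.
have -> : u + (h - i *: p) = 2%:C *: h.
  by rewrite /u addrACA subrr addr0 rmorph_nat scaler_nat mulr2n.
by rewrite cnormR h1 normr_nat; have := cnorm_ge0 u; nra.
Qed.

Lemma spectrum_bound a z : spectrum a z -> normc z <= cnorm a.
Proof.
move=> az; rewrite leNgt; apply/negP => az_lt; apply: az.
have z0 : z != 0.
  by apply: contraTneq az_lt => ->; rewrite normc0 -leNgt cnorm_ge0.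
have nz0 : 0 < normc z by apply: le_lt_trans az_lt; exact: cnorm_ge0.
have [| | |b bE _] := @neumann_inverse _ _ (z^-1 *: a) (cnorm a / normc z).
- by rewrite divr_ge0 ?cnorm_ge0 ?ltW.
- by rewrite ltr_pdivrMr // mul1r.
- by rewrite cnormZ normcV mulrC.
exists (z^-1 *: b); rewrite -[RHS]bE -scalerAl scalerAr scalerBr scalerA mulVf //.
by rewrite scale1r.
Qed.

(** This takes the place of the spectral radius formula: one of [|h|] and
    [- |h|] lies in the spectrum, as the product of [|h| - h] and [|h| + h] is
    not invertible. *)
Lemma spectrum_norm_attained h :
  star h = h -> exists2 z, spectrum h z & normc z = cnorm h.
Proof.
move=> sh; have [->|h0] := eqVneq h 0.
  exists 0; last by rewrite normc0 cnorm0.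
  by case=> b; rewrite scale0r subr0 => /not_inverse0.
have nu0 := cnorm_gt0 h0; set nu := cnorm h in nu0 *.
apply: contrapT => Hno.
have inv z : normc z = nu -> exists b : A, b * (z%:A - h) = 1.
  by move=> zn; apply: contrapT => hz; apply: Hno; exists z.
have [b1 b1E] : exists b : A, b * (nu%:C%:A - h) = 1.
  by apply: inv; rewrite normc_real ger0_norm // ltW.
have [b2 b2E] : exists b : A, b * ((- nu%:C)%:A - h) = 1.
  by apply: inv; rewrite -rmorphN normc_real normrN ger0_norm // ltW.
apply: (@one_minus_sqr_not_unit (nu^-1%:C *: h) (- (nu ^+ 2)%:C *: (b1 * b2))).
- by rewrite starR sh.
- by rewrite cnormR ger0_norm ?invr_ge0 ?ltW // mulVf // lt0r_neq0.
have nuE : nu%:C * nu^-1%:C = 1 :> R[i] by rewrite -rmorphM mulfV // lt0r_neq0.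
transitivity ((b1 * (nu%:C%:A - h)) * (b2 * ((- nu%:C)%:A - h))); last first.
  by rewrite b1E b2E mulr1.
have -> : 1 - (nu^-1%:C *: h) ^+ 2 = 1 - (nu^-1 ^+ 2)%:C *: h ^+ 2.
  by rewrite exprZn rmorphXn.
have nu2E : in_alg A (nu^+2)%:C * in_alg A (nu^-1 ^+ 2)%:C = 1.
  by rewrite -rmorphM -rmorphM -exprMn mulfV ?lt0r_neq0 // expr1n !rmorph1.
rewrite !scale_in_alg.
transitivity (- in_alg A (nu ^+ 2)%:C * (b1 * b2) +
  in_alg A (nu ^+ 2)%:C * in_alg A (nu^-1 ^+ 2)%:C * (b1 * b2 * h ^+ 2)).
  by rewrite !rmorphN /= ; ring.
by rewrite nu2E; ring.
Qed.

(** If no root [w] of [z - p] were in the spectrum of [a], then [z - p(a)]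
    would be a product of the invertible factors [a - w].  A constant [p] has no
    such factors; there one needs that the spectrum of [a] is nonempty. *)
Lemma spectrum_horner_alg a p z : star a = a ->
  spectrum (horner_alg a p) z -> exists2 w, spectrum a w & p.[w] = z.
Proof.
move=> sa pz; pose P := z%:P - p.
have [P0|P0] := eqVneq P 0.
  have [w aw _] := spectrum_norm_attained sa; exists w => //.
  by move/eqP: P0; rewrite subr_eq0 => /eqP <-; rewrite hornerC.
apply: contrapT => Hno; apply: pz.
have inv w : root P w -> exists b : A, b * (w%:A - a) = 1.
  rewrite /root hornerD hornerN hornerC subr_eq0 => /eqP zw.
  by apply: contrapT => aw; apply: Hno; exists w.
have -> : z%:A - horner_alg a p = horner_alg a P.
  by rewrite rmorphB /= horner_algC.
have [r rE] := closed_field_poly_normal P.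
have Hr : {in r, forall w, exists b : A, b * (w%:A - a) = 1}.
  move=> w wr; apply: inv; rewrite rE rootZ ?lead_coef_eq0 // root_prod_XsubC //.
have c0 : lead_coef P != 0 by rewrite lead_coef_eq0.
move: (lead_coef P) c0 rE => c c0 ->.
elim: r Hr => [|w r IHr] Hr.
  exists (c^-1)%:A; rewrite big_nil linearZ /= rmorph1.
  by rewrite mulr_algl mulr1 scalerA mulVf // scale1r.
have [b bE] : exists b : A, b * (w%:A - a) = 1 by apply: Hr; rewrite mem_head.
have [v vr|d dE] := IHr; first by apply: Hr; rewrite inE vr orbT.
exists (- b * d); rewrite big_cons scalerAr rmorphM /= -[RHS]dE.
rewrite rmorphB /= horner_algX horner_algC -[X in _ = X]mul1r -[in RHS]bE.
by move: (horner_alg _ _) => H; ring.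
Qed.

Lemma star_horner_alg a p :
  star a = a -> star (horner_alg a p) = horner_alg a (map_poly (@conjc R) p).
Proof.
move=> sa; elim/poly_ind: p => [|p c IHp].
  by rewrite !rmorph0 star0.
rewrite !(rmorphD, rmorphM) /= starD starM IHp map_polyX !horner_algX sa.
by rewrite map_polyC /= !horner_algC starZ star1 mulrC.
Qed.

(** For self-adjoint [b] the norm is the spectral radius; apply this to
    [b = p(a)^* p(a)], whose spectrum consists of the values [|p(w)|^2]. *)
Lemma cnorm_horner_alg a p e : cpos a ->
  (forall w, spectrum a w -> normc p.[w] <= e) -> cnorm (horner_alg a p) <= e.
Proof.
move=> [sa a0] pe; set b := horner_alg a p.
have sb : star (star b * b) = star b * b by rewrite starM starK.
have [z bz zE] := spectrum_norm_attained sb.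
have : spectrum (horner_alg a (map_poly (@conjc R) p * p)) z.
  by rewrite rmorphM /= -star_horner_alg.
case/(spectrum_horner_alg sa) => w aw wz; apply: le_trans (pe _ aw).
have /ger0_Im w0 := a0 _ aw.
have wE : w = w^*%C by case: (w) w0 => u v /= ->; rewrite oppr0.
rewrite -ler_sqr ?nnegrE ?cnorm_ge0 //; last first.
  by case: (p.[w]) => u v; rewrite /= sqrtr_ge0.
rewrite -cnorm_starM -zE -wz hornerM {1}wE horner_map normcM expr2.
by case: (p.[w]) => u v; rewrite /= sqrrN.
Qed.

End SpectralNorm.

(** * The square root of a positive element *)

Section SquareRoot.
Context {R : realType}.

(** These polynomials increase to the square root on the interval from [0] to
    [c ^+ 2]. *)
Fixpoint sqrt_poly (c : R) (n : nat) : {poly R} :=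
  if n is m.+1 then
    sqrt_poly c m + (2 * c)^-1 *: ('X - sqrt_poly c m ^+ 2)
  else 0.

(** The error [d] at stage [n] is multiplied by [1 - (2 s - d) / (2 c)], which
    is at most [1 - d / (2 c)]; iterating [y |-> y - y^2] from [y <= 1 / 2]
    gives [y <= 1 / (n + 2)]. *)
Lemma sqrt_poly_error (c s : R) n : 0 < c -> 0 <= s -> s <= c ->
  0 <= s - (sqrt_poly c n).[s ^+ 2] <= 2 * c / n.+2%:R.
Proof.
move=> c0 s0 sc.
set d := fun n => s - (sqrt_poly c n).[s ^+ 2].
have dS m : d m.+1 = d m - (2 * c)^-1 * (d m * (s + (sqrt_poly c m).[s ^+ 2])).
  by rewrite /d /= hornerD hornerZ hornerD hornerN hornerX horner_exp; ring.
have c2 : (2 * c)^-1 * (2 * c) = 1 by rewrite mulVf // mulf_neq0 ?lt0r_neq0.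
have k0 : 0 < (2 * c)^-1 by rewrite invr_gt0; lra.
suff H : 0 <= d n /\ d n <= s /\ d n * n.+2%:R <= 2 * c.
  have [d0 [_ dn]] := H.
  by rewrite -/(d n) d0 /= ler_pdivlMr ?ltr0n.
set k := (2 * c)^-1 in dS c2 k0.
elim: n => [|n [d0 [ds dn]]]; first by rewrite /d /= horner0; lra.
have qE : (sqrt_poly c n).[s ^+ 2] = s - d n by rewrite /d; ring.
rewrite dS qE; set x := d n in d0 ds dn *.
have kd : k * (s + (s - x)) <= 1 by rewrite -c2; apply: ler_wpM2l; lra.
have kd0 : 0 <= k * (s + (s - x)) by apply: mulr_ge0; lra.
have dec : x - k * (x * (s + (s - x))) <= x - k * x ^+ 2.
  have : 0 <= (k * x) * (s - x) by rewrite !mulr_ge0 //; lra.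
  lra.
split; first by nra.
split; first by nra.
set N := n.+2%:R in dn.
have NE : n.+3%:R = N + 1 :> R by rewrite /N -natr1.
have N2 : 2 <= N by rewrite /N ler_nat.
rewrite NE; apply: le_trans (ler_wpM2r _ dec) _; first by lra.
(* y = x / (2 c) and N = n + 2 *)
set y := k * x.
have xE : x = 2 * c * y by rewrite /y mulrA [2 * c * k]mulrC c2 mul1r.
have y0 : 0 <= y by rewrite /y mulr_ge0 // ltW.
have yN : y * N <= 1.
  have -> : y * N = k * (x * N) by rewrite /y mulrA.
  by rewrite -c2; apply: ler_wpM2l => //; exact: ltW.
have yN1 : (y - y ^+ 2) * (N + 1) <= 1 by nra.
have -> : x - k * x ^+ 2 = 2 * c * (y - y ^+ 2).
  rewrite mulrBr -xE; congr (_ - _); transitivity (k * (2 * c) * (k * x ^+ 2)).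
    by rewrite c2 mul1r.
  by rewrite /y; ring.
have c20 : 0 <= 2 * c by lra.
by have := ler_wpM2l c20 yN1; lra.
Qed.

Context {A : commCStarType R}.
Implicit Types (a b : A).

Lemma cpos_spectrum a z : cpos a -> spectrum a z ->
  exists s : R, [/\ 0 <= s, s <= cnorm a + 1 & z = (s ^+ 2)%:C].
Proof.
move=> [_ a0] az; have z0 := a0 _ az.
have := spectrum_bound az.
have zE : z = (complex.Re z)%:C by rewrite RRe_real // ger0_real.
have t0 : 0 <= complex.Re z by move: z0; rewrite zE lecR.
rewrite zE normc_real ger0_norm // => ta.
have := sqr_sqrtr t0; have := sqrtr_ge0 (complex.Re z).
set s := Num.sqrt _ => s0 s2; exists s; split=> //; last by rewrite s2.
by have := cnorm_ge0 a; nra.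
Qed.

Lemma sqrtC_sqr (s : R) : 0 <= s -> sqrtC (s ^+ 2)%:C = s%:C.
Proof. by move=> s0; rewrite rmorphXn /= sqrCK // lecR. Qed.

(** Uniform approximation on the spectrum makes [q n] evaluated at [a] a Cauchy
    sequence, by [cnorm_horner_alg]. *)
Lemma is_cfc_sqrt_exists a : cpos a -> exists b, is_cfc sqrtC a b.
Proof.
move=> pa; pose c := cnorm a + 1.
have c0 : 0 < c by have := cnorm_ge0 a; rewrite /c; lra.
pose q n := map_poly (real_complex R) (sqrt_poly c n).
pose err n : R := 2 * c / n.+2%:R.
have err_small e : 0 < e -> exists K, forall n, (K <= n)%N -> err n <= e.
  move=> e0; exists (Num.bound (2 * c / e)) => n Kn.
  rewrite /err ler_pdivrMr ?ltr0n // [e * _]mulrC -ler_pdivrMr //.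
  apply: ltW; apply: lt_le_trans (archi_boundP _) _.
    by rewrite divr_ge0 ?ltW // mulr_gt0.
  by rewrite ler_nat; apply: leq_trans Kn _; rewrite -addn2 leq_addr.
have qerr n z : spectrum a z -> normc ((q n).[z] - sqrtC z) <= err n.
  case/(cpos_spectrum pa) => s [s0 sc ->].
  rewrite sqrtC_sqr // horner_map -rmorphB normc_real distrC ger0_norm.
    by have /andP[] := sqrt_poly_error n c0 s0 sc.
  by have /andP[] := sqrt_poly_error n c0 s0 sc.
have [|b Hb] := @cnorm_complete R A (fun n => horner_alg a (q n)).
  move=> e e0; have [|K HK] := err_small (e / 2); first by rewrite divr_gt0.
  exists K => m n Km Kn; rewrite -rmorphB /=.
  apply: cnorm_horner_alg => // w aw; rewrite hornerD hornerN.
  rewrite -(subrKA (sqrtC w)); apply: le_trans (le_normcD _ _) _.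
  rewrite [X in _ + X](_ : _ = normc ((q n).[w] - sqrtC w)); last first.
    by rewrite -[RHS]normcN opprB.
  rewrite (splitr e); apply: lerD; apply: le_trans (qerr _ _ aw) _; exact: HK.
exists b => e e0; have [K HK] := Hb _ e0; have [K' HK'] := err_small _ e0.
exists (q (maxn K K')); split; last by apply: HK; rewrite leq_maxl.
by move=> z az; apply: le_trans (qerr _ _ az) _; apply: HK'; rewrite leq_maxr.
Qed.

(** If [p] is close to the square root on the spectrum, then [p^2 - X] is small
    there, hence so is [p(a)^2 - a]. *)
Lemma is_cfc_sqrt_sqr a b : cpos a -> is_cfc sqrtC a b -> b ^+ 2 = a.
Proof.
move=> pa ab; pose c := cnorm a + 1.
have a0 := cnorm_ge0 a; have b0 := cnorm_ge0 b.
pose K := (2 * c + 1) + (2 * cnorm b + 1).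
have K0 : 0 < K by rewrite /K /c; lra.
have bnd e : 0 < e -> e <= 1 -> cnorm (b ^+ 2 - a) <= e * K.
  move=> e0 e1; have [p [pe pb]] := ab _ e0.
  have -> : b ^+ 2 - a = horner_alg a (p ^+ 2 - 'X) - (horner_alg a p ^+ 2 - b ^+ 2).
    by rewrite rmorphB rmorphXn /= horner_algX; ring.
  apply: le_trans (ler_cnormB _ _) _; rewrite mulrDr; apply: lerD.
    apply: cnorm_horner_alg => // w aw; have := pe _ aw.
    have [s [s0 sc ->]] := cpos_spectrum pa aw; rewrite sqrtC_sqr // !hornerE.
    set d := _ - s%:C => de.
    have -> : p.[(s ^+ 2)%:C] ^+ 2 - (s ^+ 2)%:C = d * (d + (2 * s)%:C).
      by rewrite /d !(rmorphXn, rmorphM, rmorph_nat) /=; ring.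
    have := le_normcD d (2 * s)%:C; rewrite normc_real ger0_norm; last by lra.
    rewrite normcM => dD; apply: ler_pM => //.
    - by case: (d) => u v; rewrite sqrtr_ge0.
    - by case: (d + _) => u v; rewrite sqrtr_ge0.
    - by apply: le_trans dD _; rewrite /c; lra.
  rewrite subr_sqr; apply: le_trans (ler_cnormM _ _) _.
  apply: ler_pM => //; rewrite ?cnorm_ge0 //.
  set u := horner_alg a p in pb *.
  have -> : u + b = (u - b) + b + b by ring.
  have := ler_cnormD (u - b + b) b; have := ler_cnormD (u - b) b; lra.
apply/eqP; rewrite -subr_eq0; apply/eqP/cnorm_eq0/eqP.
rewrite eq_le cnorm_ge0 andbT; apply/ler_addgt0Pr => e e0; rewrite add0r.
pose e' := Num.min 1 (e / K).
apply: le_trans (bnd e' _ _) _; first by rewrite lt_min ltr01 divr_gt0.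
  by rewrite ge_min lexx.
by rewrite -ler_pdivlMr // ge_min lexx orbT.
Qed.

Lemma csqrt_sqr a : cpos a -> csqrt a ^+ 2 = a.
Proof.
move=> pa; apply: is_cfc_sqrt_sqr => //; rewrite /csqrt /cfc.
by case: xgetP => [b -> //|H]; have [b /H] := is_cfc_sqrt_exists pa.
Qed.

End SquareRoot.

Lemma modulus_sqr {R : realType} {A : commCStarType R} {E : preHilbertType A}
  (x : E) : modulus x ^+ 2 = inner x x.
Proof. exact/csqrt_sqr/inner_pos. Qed.

(** * Positive semidefinite forms and averages of a linear map *)

Record psd_form {R : realType} {V : lmodType R} (B : V -> V -> R) : Prop := {
  psd_linear : forall c u v w, B (c *: u + v) w = c * B u w + B v w;
  psd_sym : forall u v, B u v = B v u;
  psd_ge0 : forall u, 0 <= B u u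
}.

Section Form.
Context {R : realType} {V : lmodType R} {B : V -> V -> R}.
Hypothesis hB : psd_form B.
Implicit Types (u v w : V).

Lemma psd0l w : B 0 w = 0.
Proof.
by have := psd_linear hB 1 0 0 w; rewrite scaler0 addr0 mul1r; lra.
Qed.

Lemma psdDl u v w : B (u + v) w = B u w + B v w.
Proof. by have := psd_linear hB 1 u v w; rewrite scale1r mul1r. Qed.

Lemma psdZl c u w : B (c *: u) w = c * B u w.
Proof. by have := psd_linear hB c u 0 w; rewrite !addr0 psd0l addr0. Qed.

Lemma psdBl u v w : B (u - v) w = B u w - B v w.
Proof. by rewrite psdDl -scaleN1r psdZl mulN1r. Qed.

Lemma psd_suml (I : Type) (r : seq I) (F : I -> V) w :
  B (\sum_(i <- r) F i) w = \sum_(i <- r) B (F i) w.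
Proof.
by elim: r => [|i r IH]; rewrite ?big_nil ?psd0l // !big_cons psdDl IH.
Qed.

Lemma psdDr u v w : B w (u + v) = B w u + B w v.
Proof. by rewrite !(psd_sym hB w) psdDl. Qed.

Lemma psdZr c u w : B w (c *: u) = c * B w u.
Proof. by rewrite !(psd_sym hB w) psdZl. Qed.

Lemma psdBr u v w : B w (u - v) = B w u - B w v.
Proof. by rewrite !(psd_sym hB w) psdBl. Qed.

Lemma psd_sumr (I : Type) (r : seq I) (F : I -> V) w :
  B w (\sum_(i <- r) F i) = \sum_(i <- r) B w (F i).
Proof.
by rewrite (psd_sym hB) psd_suml; apply: eq_bigr => i _; rewrite (psd_sym hB).
Qed.

(** Young's inequality: [2 |B u v| <= t * B u u + t^-1 * B v v]. *)
Lemma psd_sqrB_le (t : R) u v : 0 < t ->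
  B (u - v) (u - v) <= (1 + t) * B u u + (1 + t^-1) * B v v.
Proof.
move=> t0; have tt : t^-1 * t = 1 by rewrite mulVf // lt0r_neq0.
have ti : 0 < t^-1 by rewrite invr_gt0.
have := mulr_ge0 (ltW ti) (psd_ge0 hB (t *: u + v)).
rewrite !(psdBl, psdBr, psdDl, psdDr, psdZl, psdZr) (psd_sym hB v u).
have -> : t^-1 * (t * (t * B u u) + t * B u v + (t * B u v + B v v)) =
   (t^-1 * t) * (t * B u u + 2 * B u v) + t^-1 * B v v by ring.
rewrite tt; lra.
Qed.

(** Convexity of the square: the variance of the [u n] is nonnegative. *)
Lemma psd_average_le (u : nat -> V) N : (0 < N)%N ->
  B ((N%:R : R)^-1 *: \sum_(0 <= n < N) u n) (N%:R^-1 *: \sum_(0 <= n < N) u n)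
    <= N%:R^-1 * \sum_(0 <= n < N) B (u n) (u n).
Proof.
move=> N0; have NR : (0 : R) < N%:R by rewrite ltr0n.
set m := _ *: _.
have mE : \sum_(0 <= n < N) B (u n) m = N%:R * B m m.
  by rewrite -psd_suml {2}/m psdZl mulrA mulfV ?mul1r // lt0r_neq0.
have : 0 <= \sum_(0 <= n < N) B (u n - m) (u n - m).
  by apply: sumr_ge0 => n _; exact: psd_ge0.
have -> : \sum_(0 <= n < N) B (u n - m) (u n - m) =
    \sum_(0 <= n < N) B (u n) (u n) - 2 * \sum_(0 <= n < N) B (u n) m
      + \sum_(0 <= n < N) B m m.
  rewrite mulr_sumr -sumrB -big_split /=; apply: eq_bigr => n _.
  by rewrite psdBl !psdBr (psd_sym hB m (u n)); ring.
rewrite mE sumr_const_nat subn0 -mulr_natl => H.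
by rewrite mulrC ler_pdivlMr // mulrC; lra.
Qed.

End Form.

Lemma iter_linear {K : pzRingType} {V : lmodType K} (T : {linear V -> V}) n :
  linear (iter n T).
Proof. by elim: n => [|n IH] c u v //=; rewrite IH linearP. Qed.

Section Averages.
Context {R : realType} {V : lmodType R} (T : {linear V -> V}).
Implicit Types (u v w x : V).

Definition average N x : V := (N%:R : R)^-1 *: \sum_(0 <= n < N) iter n T x.

Lemma iterB n u v : iter n T (u - v) = iter n T u - iter n T v.
Proof. by rewrite addrC -scaleN1r iter_linear scaleN1r addrC. Qed.

Lemma average_cobound N v w :
  average N (v - (w - T w)) = average N v - N%:R^-1 *: (w - iter N T w).
Proof.
rewrite /average -scalerBr; congr (_ *: _).
rewrite (eq_bigr (fun n => iter n T v - (iter n T w - iter n.+1 T w))); last first.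
  by move=> n _; rewrite !iterB -iterSr.
rewrite sumrB; congr (_ - _); elim: N => [|N IH].
  by rewrite big_nil subrr.
by rewrite big_nat_recr //= IH subrKA.
Qed.

(** Adding a coboundary [w - T w] changes the averages by [O(1 / N)] only. *)
Lemma psd_average_cobound_le (B : V -> V -> R) N v w (M c : R) :
  psd_form B -> (0 < N)%N -> (forall n, B (iter n T w) (iter n T w) <= c) ->
  N%:R^-1 * \sum_(0 <= n < N) B (iter n T v) (iter n T v) <= M ->
  B (average N (v - (w - T w))) (average N (v - (w - T w))) <= M + (M + 8 * c) / N%:R.
Proof.
move=> hB N0 wc vM; have NR : (1 : R) <= N%:R by rewrite ler1n.
set t := (N%:R : R)^-1; have t0 : 0 < t by rewrite invr_gt0; lra.
have tN : t * N%:R = 1 by rewrite mulVf // lt0r_neq0; lra.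
have t1 : t <= 1 by nra.
rewrite average_cobound; apply: le_trans (psd_sqrB_le hB _ _ t0) _.
have avM : B (average N v) (average N v) <= M.
  exact: le_trans (psd_average_le hB _ N0) vM.
have wM : B (w - iter N T w) (w - iter N T w) <= 4 * c.
  have := psd_sqrB_le hB w (iter N T w) ltr01; rewrite invr1.
  by have := wc 0%N; have := wc N; rewrite /=; lra.
have P0 := psd_ge0 hB (average N v).
move: (average N v) avM P0 => P avM P0.
rewrite (psdZl hB) (psdZr hB) -/t /t invrK -/t.
have c0 : 0 <= c by apply: le_trans (wc 0%N); exact: psd_ge0.
set Q := B (w - _) _ in wM *; have Q0 : 0 <= Q by exact: psd_ge0.
have -> : (1 + N%:R) * (t * (t * Q)) = t * (t * Q) + (t * N%:R) * (t * Q) by ring.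
rewrite tN mul1r.
have : t * (t * Q) <= t * Q by apply: ler_piMl => //; rewrite mulr_ge0 // ltW.
nra.
Qed.

Lemma iter_cobound j x : exists w, iter j T x = x + (w - T w).
Proof.
elim: j => [|j [w wE]]; first by exists 0; rewrite linear0 subr0 addr0.
exists (T w - x); rewrite iterS wE !linearD !linearN /=.
by rewrite opprK [- _ + T x]addrC [RHS]addrA [x + _]addrC subrK addrCA.
Qed.

Lemma shifted_average_cobound J x : (0 < J)%N ->
  exists w, T (average J x) = x + (w - T w).
Proof.
move=> J0; have JR : (J%:R : R) != 0 by rewrite pnatr_eq0 -lt0n.
have [w wE] := choice (fun j => iter_cobound j.+1 x).
exists ((J%:R : R)^-1 *: \sum_(0 <= j < J) w j).
rewrite /average !linearZ /= !(linear_sum T) /= -scalerDr -sumrB.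
rewrite (eq_bigr (fun j => x + (w j - T (w j)))); last by move=> j _; exact: wE.
rewrite big_split /= scalerDr sumr_const_nat subn0 -[x *+ J]scaler_nat scalerA mulVf //.
by rewrite scale1r.
Qed.

(** The elements [x + (w - T w)] form an affine space containing the shifted
    averages [u = T (average J x)].  These are almost norm minimal in it for
    large [J]: since [T] contracts, averaging does not increase the norm of an
    almost minimal [v], and the averages of [x] and [v] differ by [O(1 / J)].
    An almost minimal [u] is almost orthogonal to the directions of the affine
    space, among them [u - x], so that [B x u] is close to [B u u]. *)
Lemma mean_ergodic_lower_bound (B : V -> V -> R) x (L e : R) :
  psd_form B -> (forall u, B (T u) (T u) <= B u u) ->
  (forall w, L <= B (x + (w - T w)) (x + (w - T w))) -> 0 < e ->
  exists J0, forall J, (J0 <= J)%N -> (0 < J)%N ->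
    L - e <= J%:R^-1 * \sum_(1 <= j < J.+1) B x (iter j T x).
Proof.
move=> hB contr LB e0.
have iter_contr n u : B (iter n T u) (iter n T u) <= B u u.
  by elim: n => //= n IH; apply: le_trans (contr _) IH.
pose nrm w := B (x + (w - T w)) (x + (w - T w)).
pose D := inf (range nrm).
have nrm_inf : has_inf (range nrm).
  by split; [exists (nrm 0), 0|exists 0 => _ [w _ <-]; exact: psd_ge0].
have LD : L <= D by apply: lb_le_inf; [case: nrm_inf|move=> _ [w _ <-]; exact: LB].
have Dnrm w : D <= nrm w by apply: ge_inf; [case: nrm_inf|exists w].
set X := B x x; have X0 : 0 <= X by exact: psd_ge0.
(* minimality is tested at u - t q below, where the loss is eta / t + 2 t X *)
pose t := e / (4 * X + 1).
have tX : t * (4 * X + 1) = e by rewrite mulfVK // lt0r_neq0; lra.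
have t0 : 0 < t by rewrite divr_gt0 //; lra.
pose eta := e * t / 4.
have eta0 : 0 < eta by rewrite divr_gt0 // mulr_gt0.
have [_ [w _ <-] wD] := inf_adherent eta0 nrm_inf; rewrite -/D in wD.
set v := x + (w - T w); have vE : nrm w = B v v by [].
have [J0 HJ0] : exists J0, forall J, (J0 <= J)%N ->
    B v v + 8 * B w w <= eta * J%:R.
  exists (Num.bound ((B v v + 8 * B w w) / eta)) => J J0J.
  rewrite [eta * _]mulrC -ler_pdivrMr //; apply: ltW.
  apply: lt_le_trans (archi_boundP _) _; last by rewrite ler_nat.
  by rewrite divr_ge0 ?(ltW eta0) // addr_ge0 ?mulr_ge0 //; exact: psd_ge0.
exists J0 => J J0J Jpos; have JR : (0 : R) < J%:R by rewrite ltr0n.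
set u := T (average J x).
have -> : J%:R^-1 * \sum_(1 <= j < J.+1) B x (iter j T x) = B x u.
  by rewrite /u /average linearZ (linear_sum T) (psdZr hB) (psd_sumr hB) big_add1.
have [w' uE] := shifted_average_cobound x Jpos; rewrite -/u in uE.
have uD : B u u <= D + 2 * eta.
  apply: le_trans (contr _) _.
  have xE : x = v - (w - T w) by rewrite /v addrK.
  have avv : J%:R^-1 * \sum_(0 <= n < J) B (iter n T v) (iter n T v) <= B v v.
    rewrite ler_pdivrMl // mulr_natl.
    apply: (@le_trans _ _ (\sum_(0 <= n < J) B v v)).
      by apply: ler_sum => n _; exact: iter_contr.
    by rewrite sumr_const_nat subn0.
  have := psd_average_cobound_le hB Jpos (fun n => iter_contr n w) avv.
  rewrite /= -xE => H; apply: le_trans H _.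
  have : (B v v + 8 * B w w) / J%:R <= eta by rewrite ler_pdivrMr //; exact: HJ0.
  by rewrite -vE; lra.
have uX : B u u <= X.
  apply: le_trans (contr _) _.
  apply: le_trans (psd_average_le hB _ Jpos) _.
  rewrite ler_pdivrMl // mulr_natl.
  apply: (@le_trans _ _ (\sum_(0 <= n < J) B x x)).
    by apply: ler_sum => n _; exact: iter_contr.
  by rewrite sumr_const_nat subn0.
set q := w' - T w' in uE; have qE : q = u - x by rewrite uE addrC addKr.
have Du : D <= B u u by rewrite uE; exact: Dnrm.
have Dt : D <= B (u - t *: q) (u - t *: q).
  have -> : u - t *: q = x + ((w' - t *: w') - T (w' - t *: w')).
    have TZ : T (t *: w') = t *: T w' by exact: linearZ.
    by rewrite uE (linearB T) TZ /q scalerBr -addrA !opprD addrACA.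
  exact: Dnrm.
clearbody q; have qq : B q q <= 4 * X.
  have := psd_sqrB_le hB u x ltr01; rewrite invr1 -qE -/X; lra.
have Bxu : B x u = B u u - B q u by rewrite qE psdBl // opprB addrC subrK.
have : t * B q u <= t * e.
  move: Dt; rewrite !(psdBl hB, psdBr hB, psdZl hB, psdZr hB) (psd_sym hB u q).
  by rewrite /eta in uD; nra.
rewrite ler_pM2l // Bxu; lra.
Qed.

End Averages.

(** * Limits along ultrafilters and the limit superior of a net *)

Lemma lee_of_real_below {R : realType} (x y : \bar R) :
  (forall r : R, (r%:E < x)%E -> (r%:E <= y)%E) -> (x <= y)%E.
Proof.
case: x => [x||] H; last by rewrite leNye.
- by apply/lee_subgt0Pr => e e0; apply: H; rewrite lte_fin; lra.
- case: y H => [y||] H //.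
    by move: (H (y + 1)%R (ltry _)); rewrite lee_fin leNgt ltrDl ltr01.
  by move: (H 0%R (ltry _)); rewrite leeNy_eq.
Qed.

Lemma ultra_bounded_cvg {R : realType} {I : Type} (F : set_system I)
    (h : I -> R) (c : R) :
  UltraFilter F -> (forall i, `|h i| <= c) -> cvg (h @ F).
Proof.
move=> FU hc.
have hU : UltraFilter (h @ F).
  split=> [|G GP sFG]; first exact: fmap_proper_filter.
  apply/seteqP; split=> // A GA.
  have [//|FnA] := in_ultra_setVsetC (h @^-1` A) FU.
  have : G set0 by rewrite -(setICr A); apply: filterI => //; exact: sFG.
  by move/filter_not_empty.
have hF : F (h @^-1` `[- c, c]).
  by apply: filterE => i /=; rewrite in_itv /= -ler_norml.
have := @segment_compact R (- c) c; rewrite compact_ultra => /(_ _ hU hF).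
by move=> [l [_ hl]]; apply/cvg_ex; exists l.
Qed.

Section NetUltrafilter.
Context {R : realType} {I : Type} (le : I -> I -> Prop).

(** Ultrafilter refining the net on which [f] stays above [L]. *)
Lemma ultrafilter_of_net_limsup (f : I -> R) (L : R) :
  directed le -> (L%:E < net_limsup le f)%E ->
  exists F : set_system I, [/\ UltraFilter F,
    forall k, F [set i | le k i] & F [set i | L < f i]].
Proof.
move=> [[i0] refl trans dir] Lf.
have frequently k : exists2 i, le k i & L < f i.
  have : (L%:E < ereal_sup [set (f i)%:E | i in [set i | le k i]])%E.
    by apply: lt_le_trans Lf _; apply: ereal_inf_lbound; exists k.
  by case/ereal_sup_gt => _ [i ki <-]; rewrite lte_fin; exists i.
pose tail k := [set i | le k i /\ L < f i].
have tailF : Filter (filter_from [set: I] tail).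
  apply: filter_fromT_filter; first by exists i0.
  move=> i j; have [k [ik jk]] := dir i j; exists k => l [kl Ll].
  by split; split=> //; [exact: trans ik kl|exact: trans jk kl].
have tailP : ProperFilter (filter_from [set: I] tail).
  apply: filter_from_proper => k _.
  by have [i ki Li] := frequently k; exists i.
have [F [FU tF]] := ultraFilterLemma tailP; exists F; split=> //.
- by move=> k; apply: tF; exists k => // i [].
- by apply: tF; exists i0 => // i [].
Qed.

Lemma lim_le_net_limsup (F : set_system I) (h : I -> R) :
  ProperFilter F -> (forall k, F [set i | le k i]) -> cvg (h @ F) ->
  ((lim (h @ F))%:E <= net_limsup le h)%E.
Proof.
move=> FF Ftail hcv; apply: le_ereal_inf_tmp => _ [k _ <-].
apply: lee_of_real_below => r; rewrite lte_fin => rl.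
have Fr : F [set i | r < h i] by exact: (cvgr_gt _ hcv).
have Fkr : F ([set i | le k i] `&` [set i | r < h i]) by exact: filterI.
have [i [ki ri]] := filter_ex Fkr; apply: (@le_trans _ _ (h i)%:E).
  by rewrite lee_fin ltW.
by apply: ereal_sup_ubound; exists i.
Qed.

End NetUltrafilter.

(** * Positive functionals on the algebra and the forms that they induce *)

Section Positive.
Context {R : realType} {A : commCStarType R}.
Implicit Types (a : A) (phi : A -> R[i]).

Definition positive_functional phi : Prop :=
  scalar phi /\ forall a, cpos a -> 0 <= phi a.

(** The spectrum of a positive [a] lies between [0] and [|a|]. *)
Lemma cpos_norm_sub a : cpos a -> cpos ((cnorm a)%:C%:A - a).
Proof.
move=> pa; have [sa a0] := pa; split; first by rewrite starB starR star1 sa.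
move=> z az; set c := (cnorm a)%:C in az.
have cz : spectrum a (c - z).
  case=> b bE; apply: az; exists (- b); rewrite -[RHS]bE.
  by rewrite !scale_in_alg; ring.
have := a0 _ cz; have := spectrum_bound cz; rewrite /c.
case: z {az cz} => u v /=; rewrite !lecE /= => H /andP[/eqP v0 _].
have {}v0 : v = 0 by lra.
rewrite v0 eqxx /=; move: H; rewrite v0 subr0 expr0n addr0 sqrtr_sqr.
by rewrite ler_norml; lra.
Qed.

Lemma Re_scale (c : R) (z : R[i]) : complex.Re (c%:C * z) = c * complex.Re z.
Proof. by case: z => u v /=; rewrite mul0r subr0. Qed.

Lemma scalar_fun0 phi : scalar phi -> phi 0 = 0.
Proof. by move=> /(_ (-1) 0 0); rewrite scaleN1r oppr0 addr0 mulN1r addNr. Qed.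

Lemma markov_iter_positive (S : {linear A -> A}) (mu : {scalar A}) n :
  markov_operator S -> state mu -> positive_functional (fun a => mu (iter n S a)).
Proof.
move=> [_ _ Spos] [_ mupos _]; split.
  by move=> c a b; rewrite iter_linear linearP.
by move=> a pa; apply: mupos; elim: n => //= n; exact: Spos.
Qed.

Lemma state1_le1 (mu : {scalar A}) : state mu -> complex.Re (mu 1) <= 1.
Proof.
move=> [[M muM] mupos <-].
have p1 : cpos (1 : A).
  split; first exact: star1.
  move=> z z1; have [/eqP|z1'] := eqVneq z 1; first by move/eqP ->.
  case: z1; exists (z - 1)^-1%:A.
  have -> : z%:A - 1 = (z - 1)%:A :> A by rewrite scalerBl scale1r.
  by rewrite mulr_algl scalerA mulVf ?scale1r // subr_eq0.
apply: (@le_trans _ _ (normc (mu 1))).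
  have := mupos _ p1; case: (mu 1) => u v; rewrite lecE /= => /andP[/eqP -> u0].
  by rewrite expr0n addr0 sqrtr_sqr ler_norm.
apply: ub_le_sup; last by exists 1 => //=; rewrite cnorm1.
exists `|M| => _ [a /= a1 <-]; apply: le_trans (muM a) _.
apply: le_trans (ler_norm _) _; rewrite normrM ler_piMr //.
by rewrite ger0_norm ?cnorm_ge0.
Qed.

Lemma markov_state_bound (S : {linear A -> A}) (mu : {scalar A}) n a :
  markov_operator S -> state mu -> cpos a ->
  complex.Re (mu (iter n S a)) <= cnorm a.
Proof.
move=> mS smu pa; have [phiL phi0] := markov_iter_positive n mS smu.
have S1 : iter n S 1 = 1 by case: mS => _ S1 _; elim: n {phiL phi0} => //= n ->.
have := phi0 _ (cpos_norm_sub pa).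
rewrite -scaleN1r addrC phiL addrC -{1}[_%:A]addr0 phiL.
rewrite (scalar_fun0 phiL) addr0 S1 lecE mulN1r => /andP[_].
rewrite raddfD raddfN /= Re_scale => H.
by have := state1_le1 smu; have := cnorm_ge0 a; nra.
Qed.

End Positive.

(** * The forms induced by positive functionals *)

Section Realification.
Context {R : realType} {A : commCStarType R} (E : preHilbertType A).

(** [E] as a real vector space, on which the real part of a positive functional
    of [(u|v)] is a symmetric bilinear form. *)
Definition realification : Type := E.

HB.instance Definition _ := GRing.Zmodule.on realification.

Definition real_scale (c : R) (u : realification) : realification :=
  (c%:C%:A : A) *: (u : E).

Lemma real_scaleA a b u : real_scale a (real_scale b u) = real_scale (a * b) u.
Proof. by rewrite /real_scale scalerA mulr_algl scalerA -rmorphM. Qed.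

Lemma real_scale1 : left_id 1 real_scale.
Proof. by move=> u; rewrite /real_scale rmorph1 !scale1r. Qed.

Lemma real_scaleDr : right_distributive real_scale +%R.
Proof. by move=> c u v; rewrite /real_scale scalerDr. Qed.

Lemma real_scaleDl u : {morph real_scale^~ u : a b / a + b}.
Proof. by move=> a b; rewrite /real_scale rmorphD !scalerDl. Qed.

HB.instance Definition _ := GRing.Zmodule_isLmodule.Build R realification
  real_scaleA real_scale1 real_scaleDr real_scaleDl.

Definition functional_form (phi : A -> R[i]) (u v : realification) : R :=
  complex.Re (phi (inner (u : E) (v : E))).

Lemma inner_scalel (c : R[i]) (u v : E) : inner (c%:A *: u) v = c *: inner u v.
Proof.
have := inner_linear c%:A u 0 v; rewrite addr0 mulr_algl => ->.
suff -> : inner (0 : E) v = 0 by rewrite addr0.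
have := inner_linear (-1) (0 : E) 0 v.
by rewrite scaleN1r oppr0 addr0 mulN1r addNr.
Qed.

Lemma inner_addl (u v w : E) : inner (u + v) w = inner u w + inner v w.
Proof. by have := inner_linear 1 u v w; rewrite scale1r mul1r. Qed.

Lemma inner_addr (u v w : E) : inner w (u + v) = inner w u + inner w v.
Proof. by rewrite -!(inner_star _ w) inner_addl starD. Qed.

Lemma inner_scaler (c : R[i]) (u v : E) :
  inner v (c%:A *: u) = (c^*%C) *: inner v u.
Proof. by rewrite -!(inner_star _ v) inner_scalel starZ. Qed.

(** A positive functional takes real values on the elements [(u|u)].  Applied to
    [u + i v] this says that [i ((v|u) - (u|v))] has a real value, which is the
    symmetry of the real part. *)
Lemma functional_form_psd phi :
  positive_functional phi -> psd_form (functional_form phi).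
Proof.
move=> [phiL phi0].
have phi00 : phi 0 = 0.
  exact: scalar_fun0.
have phiD a b : phi (a + b) = phi a + phi b.
  by have := phiL 1 a b; rewrite scale1r mul1r.
have phiZ c a : phi (c *: a) = c * phi a.
  by have := phiL c a 0; rewrite !addr0 phi00 addr0.
have phi_real (u : E) : complex.Im (phi (inner u u)) = 0.
  by apply: ger0_Im; apply: phi0; exact: inner_pos.
split.
- move=> c u v w; rewrite /functional_form inner_addl inner_scalel phiL.
  by rewrite raddfD /= Re_scale.
- move=> u v; rewrite /functional_form; set i : R[i] := 0 +i* 1.
  have := phi_real ((u : E) + i%:A *: (v : E)).
  rewrite inner_addl !inner_addr !inner_scalel !inner_scaler scalerA !phiD !phiZ.
  have := phi_real u; have := phi_real v.
  case: (phi (inner u u)) => a a'; case: (phi (inner v v)) => b b'.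
  case: (phi (inner (u : E) (v : E))) => c c'.
  case: (phi (inner (v : E) (u : E))) => d d'.
  rewrite /=; lra.
- move=> u; rewrite /functional_form.
  have := phi0 _ (inner_pos (u : E)); case: (phi _) => a b.
  by rewrite lecE /= => /andP[].
Qed.

End Realification.

Lemma psd_form_mean {R : realType} {V : lmodType R} (B : nat -> V -> V -> R) N :
  (forall n, psd_form (B n)) ->
  psd_form (fun u v => N%:R^-1 * \sum_(0 <= n < N) B n u v).
Proof.
move=> hB; split.
- move=> c u v w; rewrite mulrCA -mulrDr; congr (_ * _).
  rewrite mulr_sumr -big_split /=; apply: eq_bigr => n _.
  exact: (psd_linear (hB n)).
- by move=> u v; congr (_ * _); apply: eq_bigr => n _; rewrite (psd_sym (hB n)).
- move=> u; rewrite mulr_ge0 ?invr_ge0 ?ler0n //.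
  by apply: sumr_ge0 => n _; exact: (psd_ge0 (hB n)).
Qed.

Lemma psd_norm_le {R : realType} {V : lmodType R} (B : V -> V -> R) u v :
  psd_form B -> `|B u v| <= B u u + B v v.
Proof.
move=> hB; have := psd_ge0 hB (u + v); have := psd_ge0 hB (u - v).
rewrite !(psdBl hB, psdBr hB, psdDl hB, psdDr hB) (psd_sym hB v u).
have := psd_ge0 hB u; have := psd_ge0 hB v.
rewrite ler_norml; lra.
Qed.

Lemma psd_form_lim {R : realType} {V : lmodType R} {I : Type} (F : set_system I)
    (B : I -> V -> V -> R) :
  ProperFilter F -> (forall i, psd_form (B i)) ->
  (forall u v, cvg ((fun i => B i u v) @ F)) ->
  psd_form (fun u v => lim ((fun i => B i u v) @ F)).
Proof.
move=> FF hB Bcv; split.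
- move=> c u v w; apply/cvg_lim => //.
  have -> : (fun i => B i (c *: u + v) w) = (fun i => c * B i u w + B i v w).
    by apply: funext => i; rewrite (psd_linear (hB i)).
  by apply: cvgD; [apply: cvgM; [exact: cvg_cst|exact: Bcv]|exact: Bcv].
- move=> u v; congr (lim (_ @ F)); apply: funext => i; exact: (psd_sym (hB i)).
- by move=> u; apply: limr_ge => //; apply: nearW => i; exact: (psd_ge0 (hB i)).
Qed.

(** * Dominated operators *)

Lemma bounded_operator_real_linear {R : realType} {A : commCStarType R}
    {E : preHilbertType A} (T : E -> E) : bounded_operator T ->
  linear (T : realification E -> realification E).
Proof. by move=> [TL _] c u v; exact: TL. Qed.

Definition real_operator {R : realType} {A : commCStarType R}
    {E : preHilbertType A} (T : E -> E) (bT : bounded_operator T) :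
    {linear realification E -> realification E} :=
  HB.pack (T : realification E -> realification E)
    (GRing.isLinear.Build R (realification E) (realification E) *:%R
       (T : realification E -> realification E) (bounded_operator_real_linear bT)).

Section Dominated.
Context {R : realType} {A : commCStarType R} (S : {linear A -> A}).
Context {E : preHilbertType A} (T : E -> E).
Hypotheses (mS : markov_operator S) (bT : bounded_operator T) (dT : dominated S T).
Implicit Types (mu : {scalar A}) (u v w x : realification E).

Local Notation Tr := (real_operator bT).

Lemma ergodic_averageE N x : ergodic_average T N x = average Tr N x.
Proof.
rewrite /ergodic_average /average.
have -> : (N%:R^-1 : R[i]) = (N%:R^-1 : R)%:C by rewrite fmorphV rmorph_nat.
by [].
Qed.

Definition power_form mu n : realification E -> realification E -> R :=
  functional_form (fun a => mu (iter n S a)).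

Definition mean_form mu N u v : R :=
  N%:R^-1 * \sum_(0 <= n < N) power_form mu n u v.

Context (mu : {scalar A}).
Hypothesis smu : state mu.

Lemma power_form_psd n : psd_form (power_form mu n).
Proof. exact/functional_form_psd/markov_iter_positive. Qed.

Lemma mean_form_psd N : psd_form (mean_form mu N).
Proof. exact/psd_form_mean/power_form_psd. Qed.

Lemma power_form_dominated n u :
  power_form mu n (T u) (T u) <= power_form mu n.+1 u u.
Proof.
have [phiL phi0] := markov_iter_positive n mS smu.
have := dT u; rewrite /cle !modulus_sqr => /phi0.
rewrite -scaleN1r addrC phiL mulN1r lecE => /andP[_].
by rewrite raddfD raddfN /= /power_form /functional_form iterSr; lra.
Qed.

Lemma power_form_iter m n u :
  power_form mu m (iter n T u) (iter n T u) <= power_form mu (m + n) u u.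
Proof.
elim: n m => [|n IH] m; first by rewrite addn0.
by rewrite addnS -addSn; apply: le_trans (IH _); exact: power_form_dominated.
Qed.

Lemma power_form_le n u : power_form mu n u u <= cnorm (inner (u : E) (u : E)).
Proof. exact/markov_state_bound/inner_pos. Qed.

Lemma mean_form_le N u : mean_form mu N u u <= cnorm (inner (u : E) (u : E)).
Proof.
have [->|N0] := posnP N.
  by rewrite /mean_form big_nil mulr0 cnorm_ge0.
rewrite /mean_form ler_pdivrMl ?ltr0n // mulr_natl.
apply: (@le_trans _ _ (\sum_(0 <= n < N) cnorm (inner (u : E) (u : E)))).
  by apply: ler_sum => n _; exact: power_form_le.
by rewrite sumr_const_nat subn0.
Qed.

(** Domination moves the means by one step along the orbit under [S], so that
    all but the two extreme terms cancel. *)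
Lemma mean_form_contraction N u :
  mean_form mu N (T u) (T u)
    <= mean_form mu N u u + cnorm (inner (u : E) (u : E)) / N%:R.
Proof.
rewrite /mean_form [_ / _]mulrC -mulrDr ler_wpM2l ?invr_ge0 ?ler0n //.
apply: (@le_trans _ _ (\sum_(0 <= n < N) power_form mu n.+1 u u)).
  by apply: ler_sum => n _; exact: power_form_dominated.
have telescope M : \sum_(0 <= n < M) power_form mu n.+1 u u =
    \sum_(0 <= n < M) power_form mu n u u + power_form mu M u u - power_form mu 0 u u.
  elim: M => [|M IH]; first by rewrite !big_nil; lra.
  by rewrite !big_nat_recr //= IH; lra.
rewrite telescope.
have := power_form_le N u; have := psd_ge0 (power_form_psd 0) u; lra.
Qed.

(** Here [|T^n v|^2] is dominated by [S^n |v|^2], while [|T^n w|^2] is bounded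
    uniformly in [n]. *)
Lemma form_ergodic_average_le N v w : (0 < N)%N ->
  complex.Re (mu (modulus (ergodic_average T N (v - (w - Tr w))) ^+ 2))
    <= mean_form mu N v v
    + (cnorm (inner (v : E) (v : E)) + 8 * cnorm (inner (w : E) (w : E))) / N%:R.
Proof.
move=> N0; rewrite modulus_sqr ergodic_averageE.
have iter_le n u : power_form mu 0 (iter n Tr u) (iter n Tr u) <= power_form mu n u u.
  exact: power_form_iter.
have wc n :
    power_form mu 0 (iter n Tr w) (iter n Tr w) <= cnorm (inner (w : E) (w : E)).
  exact: le_trans (iter_le n w) (power_form_le n w).
have vm : N%:R^-1 * \sum_(0 <= n < N) power_form mu 0 (iter n Tr v) (iter n Tr v)
    <= mean_form mu N v v.
  rewrite /mean_form ler_wpM2l ?invr_ge0 ?ler0n //.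
  by apply: ler_sum => n _; exact: iter_le.
apply: le_trans (psd_average_cobound_le (power_form_psd 0) N0 wc vm) _.
by rewrite lerD2l ler_wpM2r ?invr_ge0 ?ler0n // lerD2r mean_form_le.
Qed.

End Dominated.

Section Limit.
Context {R : realType} {A : commCStarType R} (S : {linear A -> A}).
Context {E : preHilbertType A} (T : E -> E).
Context (I : Type) (N : I -> nat) (mu : I -> {scalar A}) (F : set_system I).
Hypotheses (mS : markov_operator S) (bT : bounded_operator T) (dT : dominated S T).
Hypotheses (smu : forall i, state (mu i)) (N0 : forall i, (0 < N i)%N).
Hypotheses (FU : UltraFilter F) (FN : forall m, F [set i | (m <= N i)%N]).

Local Notation Tr := (real_operator bT).
Let b i := @mean_form R A S E (mu i) (N i).

(** In the limit, [T] becomes an honest contraction and the inequalities with an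
    error [O(1 / N i)] become exact. *)
Definition limit_form (u v : realification E) : R := lim ((fun i => b i u v) @ F).

Lemma mean_form_cvg u v : cvg ((fun i => b i u v) @ F).
Proof.
apply: (ultra_bounded_cvg FU) => i.
apply: le_trans (psd_norm_le u v (mean_form_psd mS (smu i) _)) _.
by apply: lerD; exact: mean_form_le.
Qed.

Lemma limit_form_psd : psd_form limit_form.
Proof.
by apply: psd_form_lim mean_form_cvg => i; exact: mean_form_psd.
Qed.

Lemma limit_form_ge (g : I -> R) (c L : R) u :
  (forall i, g i <= b i u u + c / (N i)%:R) -> F [set i | L <= g i] ->
  L <= limit_form u u.
Proof.
move=> gb Lg; apply/ler_addgt0Pr => e e0; rewrite -lerBlDr.
apply: limr_ge; first exact: mean_form_cvg.
have Fc : F [set i | c / (N i)%:R <= e].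
  apply: filterS (FN (Num.bound (`|c| / e))) => i /= iN.
  rewrite ler_pdivrMr ?ltr0n // [e * _]mulrC -ler_pdivrMr //.
  apply: (@le_trans _ _ (`|c| / e)); first by rewrite ler_pM2r ?invr_gt0 // ler_norm.
  apply: ltW; apply: lt_le_trans (archi_boundP _) _; last by rewrite ler_nat.
  by rewrite divr_ge0 // ltW.
apply: filterS2 Lg Fc => i /= Li ci; have := gb i; lra.
Qed.

Lemma limit_form_contraction u : limit_form (T u) (T u) <= limit_form u u.
Proof.
apply/ler_addgt0Pr => e e0; rewrite -lerBlDr.
apply: (@limit_form_ge (fun i => b i (T u) (T u)) (cnorm (inner (u : E) (u : E)))).
  by move=> i; exact: mean_form_contraction.
have lt_lim : limit_form (T u) (T u) - e < limit_form (T u) (T u) by lra.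
have Fr : F [set i | limit_form (T u) (T u) - e < b i (T u) (T u)].
  exact: (cvgr_gt _ (@mean_form_cvg (T u) (T u))).
by apply: filterS Fr => i /= /ltW.
Qed.

(** [L] bounds from below the limit form at every [v = x + (w - T w)], because
    the averages of [x] differ from those of [v] by [O(1 / N i)]. *)
Lemma ultralimit_bound (x : E) (L e : R) :
  F [set i | L < complex.Re (mu i (modulus (ergodic_average T (N i) x) ^+ 2))] ->
  0 < e ->
  exists J0, forall J, (J0 <= J)%N -> (0 < J)%N ->
    L - e <= J%:R^-1 * \sum_(1 <= j < J.+1) limit_form x (iter j T x).
Proof.
move=> FL e0.
apply: (@mean_ergodic_lower_bound _ _ Tr limit_form x L e limit_form_psd) => //.
  exact: limit_form_contraction.
move=> w; set v := x + _.
have xE : (x : realification E) = v - (w - Tr w) by rewrite /v addrK.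
apply: (@limit_form_ge (fun i =>
  complex.Re (mu i (modulus (ergodic_average T (N i) x) ^+ 2)))).
  by move=> i; rewrite {1}xE; exact: form_ergodic_average_le.
by apply: filterS FL => i /= /ltW.
Qed.

End Limit.

(** * Averages along a net *)

Theorem theorem4p5 (R : realType) (A : commCStarType R) (S : {linear A -> A})
    (E : preHilbertType A) (T : E -> E) (x : E)
    (I : Type) (le : I -> I -> Prop) (N : I -> nat) (mu : I -> {scalar A}) :
  markov_operator S -> bounded_operator T -> dominated S T ->
  subnet_of_nat le N -> (forall i, state (mu i)) ->
  (net_limsup le
     (fun i => complex.Re (mu i (modulus (ergodic_average T (N i) x) ^+ 2))%R)
   <= limn_einf (fun J : nat =>
        (J%:R^-1)%:E * \sum_(1 <= j < J.+1)
          net_limsup le (fun i =>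
            ((N i)%:R^-1 * \sum_(0 <= n < N i)
              complex.Re (mu i (iter n S (inner x (iter j T x)))))%R)))%E.
Proof.
move=> mS bT dT [dir N0 Nlarge] smu.
apply: lee_of_real_below => L Lf.
(* one ultrafilter serves all j at once *)
have [F [FU Ftail FL]] := ultrafilter_of_net_limsup dir Lf.
have FN m : F [set i | (m <= N i)%N].
  by have [k kN] := Nlarge m; apply: filterS (Ftail k) => i /kN.
apply/lee_subgt0Pr => e e0.
have [J0 HJ0] := ultralimit_bound mS bT dT smu N0 FU FN FL e0.
rewrite limn_einf_lim; set g := (g in einfs g).
have -> : limn (einfs g) = ereal_sup (range (einfs g)).
  by apply/cvg_lim => //; exact: cvg_einfs_sup.
apply: le_trans (ereal_sup_ubound _); last by exists (maxn J0 1).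
apply: le_ereal_inf_tmp => _ [J /= J1 <-].
have J0J : (J0 <= J)%N by apply: leq_trans J1; exact: leq_maxl.
have Jpos : (0 < J)%N by apply: leq_trans J1; exact: leq_maxr.
apply: (@le_trans _ _ ((J%:R^-1 * \sum_(1 <= j < J.+1)
    limit_form S N mu F (x : realification E) (iter j T x))%:E)).
  by rewrite -EFinB lee_fin; exact: HJ0.
rewrite EFinM -sumEFin; apply: lee_wpmul2l.
  by rewrite lee_fin invr_ge0 ler0n.
apply: lee_sum => j _; apply: lim_le_net_limsup => //.
exact: mean_form_cvg.
Qed.
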